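(* Let $D$ be a digraph of order $n\geq 5$, rank larger than $2$, with exactly one negative eigenvalue. Then one of the following cases is true (equality of digraphs meaning isomorphism): (i) $\operatorname{Rank}(D) = 3$ and either $TR(D) = T^-$, $TR(D) = T^-_a$ or $TR(D) = T^-_b$; (ii) $\operatorname{Rank}(D) = 4$ and $TR(D) = K^-$.
   Context: A digraph $D=(V,E)$ is finite with arc set $E\subseteq V\times V$ and no loops; both $(u,v)$ and $(v,u)$ may belong to $E$, in which case $\{u,v\}$ is called a digon. The Hermitian adjacency matrix $H=H(D)$ has entries $h_{uv}=1$ if $(u,v)\in E$ and $(v,u)\in E$; $h_{uv}=i$ if $(u,v)\in E$ and $(v,u)\notin E$; $h_{uv}=-i$ if $(u,v)\notin E$ and $(v,u)\in E$; and $h_{uv}=0$ otherwise. The rank and eigenvalues of $D$ are those of $H(D)$; eigenvalues are counted with multiplicity. The order of $D$ is $|V|$. Two vertices $u,v$ of $D$ are twins if $H_{ux}=H_{vx}$ for every $x\in V$ (an equivalence relation). The twin reduction $TR(D)$ is the induced subdigraph obtained from $D$ by keeping exactly one vertex of every collection (class) of twins and removing all isolated vertices (well defined up to isomorphism). In the following digraphs, the listed arcs are one-directional. $T^-$ (negative triangle): vertices $1,2,3$, digon $\{1,2\}$, arcs $(1,3),(3,2)$. $T^-_a$: vertices $1,2,3,4$, digon $\{1,2\}$, arcs $(1,3),(3,2),(2,4),(4,1)$. $T^-_b$: vertices $1,2,3,4$, digons $\{1,2\},\{3,4\}$, arcs $(1,3),(3,2),(4,1)$. $K^-$ (negative tetrahedron):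 vertices $1,2,3,4$, digons $\{1,2\},\{3,4\}$, arcs $(1,3),(3,2),(2,4),(4,1)$. *)

(* Defs.v *)
From mathcomp Require Import all_boot all_order all_algebra.

Set Implicit Arguments.
Unset Strict Implicit.
Unset Printing Implicit Defensive.

Import Order.TTheory GRing.Theory Num.Theory.
Local Open Scope ring_scope.

Record digraph := Digraph {
  vertex :> finType;
  arc : rel vertex;
  arc_irr : irreflexive arc }.
Arguments arc : clear implicits.

Definition isomorphic (D D' : digraph) : Prop :=
  exists2 f : D -> D', bijective f & forall u v, arc D' (f u) (f v) = arc D u v.

Lemma induced_irr (D : digraph) (A : {set D}) :
  irreflexive (fun u v : {x : D | x \in A} => arc D (val u) (val v)).
Proof. by move=> u; apply: arc_irr. Qed.

Definition induced (D : digraph) (A : {set D}) : digraph :=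
  Digraph (@induced_irr D A).

Section Hermitian.
Variables (C : numClosedFieldType) (D : digraph).

Definition herm (u v : D) : C :=
  if arc D u v then (if arc D v u then 1 else 'i)
  else (if arc D v u then - 'i else 0).

Definition herm_mx : 'M[C]_#|D| :=
  \matrix_(i, j) herm (enum_val i) (enum_val j).

Definition rank : nat := \rank herm_mx.

(* The roots of the (monic) characteristic polynomial, each one repeated
   according to its multiplicity. *)
Definition eigenvalues : seq C :=
  sval (closed_field_poly_normal (char_poly herm_mx)).

(* On a numClosedFieldType, x < 0 entails that x is real. *)
Definition num_neg_eigenvalues : nat := count (fun x => x < 0) eigenvalues.

Definition twins (u v : D) : bool := [forall x, herm u x == herm v x].

Definition isolated (u : D) : bool := [forall v, ~~ arc D u v && ~~ arc D v u].

(* One (arbitrarily chosen) vertex in each class of twins. Choosing other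
   representatives yields an isomorphic twin reduction. *)
Definition twin_representatives : {set D} :=
  transversal (equivalence_partition twins setT) setT.

(* A vertex is isolated in D if and only if its representative is isolated among
   the representatives, so isolated vertices can be removed as vertices of D. *)
Definition twin_reduction : digraph :=
  induced [set u in twin_representatives | ~~ isolated u].

End Hermitian.

(* The digraph with vertices 1, ..., n and the given list of arcs; the vertex k
   is encoded by the ordinal k - 1. *)
Lemma digraph_of_arcs_irr (n : nat) (s : seq (nat * nat)) :
  all (fun p => p.1 != p.2) s ->
  irreflexive (fun u v : 'I_n => (u.+1, v.+1) \in s).
Proof. by move=> /allP s_irr u; apply/negP => /s_irr /=; rewrite eqxx. Qed.

Definition digraph_of_arcs (n : nat) (s : seq (nat * nat))
    (s_irr : all (fun p => p.1 != p.2) s) : digraph :=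
  Digraph (@digraph_of_arcs_irr n s s_irr).

Definition T_neg : digraph :=
  @digraph_of_arcs 3 [:: (1, 2); (2, 1); (1, 3); (3, 2)]%N isT.

Definition T_neg_a : digraph :=
  @digraph_of_arcs 4
    [:: (1, 2); (2, 1); (1, 3); (3, 2); (2, 4); (4, 1)]%N isT.

Definition T_neg_b : digraph :=
  @digraph_of_arcs 4
    [:: (1, 2); (2, 1); (3, 4); (4, 3); (1, 3); (3, 2); (4, 1)]%N isT.

Definition K_neg : digraph :=
  @digraph_of_arcs 4
    [:: (1, 2); (2, 1); (3, 4); (4, 3); (1, 3); (3, 2); (2, 4); (4, 1)]%N isT.

(* Main.v *)
Require Import Defs.
From mathcomp Require Import all_boot all_order all_algebra.
From mathcomp Require Import ring.

(** Let [H] be the Hermitian matrix of [D] and [Q] the form with matrix [H].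
    By the spectral theorem, one negative eigenvalue means that [Q] is
    nonnegative on the kernel of some linear form; hence [Q] is nonnegative on
    the orthogonal of any negative vector, and a vector of that orthogonal on
    which [Q] vanishes is in the kernel of [H] ([hform_orth_neg_ge0],
    [hform_orth_neg_eq0]).

    An edge [uv] spans a hyperbolic plane, which contains a negative vector, so
    the previous facts apply to every vector orthogonal to [e_u] and [e_v].
    Applied to the projection of [e_w], they say that the weight
    [h_wu h_uv h_vw] of a triangle has a nonpositive real part, and that row [w]
    is a combination of rows [u] and [v] as soon as that real part vanishes
    ([triangle_weight]).  If it vanished for all [w], the rank would be at most
    2.  So some triangle has weight [-1]: its entries are [1], [i], [i] or [1],
    [-i], [-i], which makes it a negative triangle on vertices [u1], [u2], [u3].

    Fix that triangle.  The row of a vertex [w] is then found from its entries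
    at [u1], [u2] and [u3]: by [triangle_weight] when the triangle [w u1 u2] has
    weight of real part 0, and otherwise by comparing [e_w] with the one of
    [e_u3] and [- e_u3] that has the same entries at [u1] and [u2]
    ([proportional_on_edge]).  Up to
    twins and isolated vertices there remain [u1], [u2], [u3] and four further
    types: row [- row u3], row [i row u2], row [- i row u1], and the apex of a
    negative tetrahedron ([row_classification]).  Two vertices of different
    further types cannot coexist, because the entry between them would be [-1],
    and two vertices of the same further type are twins.  So the twin reduction
    is the negative triangle with at most one more vertex.  The rank is read on
    the rows: the first three further types are combinations of the rows of the
    triangle, whereas the rows of a negative tetrahedron are independent. *)

Set Implicit Arguments.
Unset Strict Implicit.
Unset Printing Implicit Defensive.

Import Order.TTheory GRing.Theory Num.Theory.
Local Open Scope ring_scope.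
Local Open Scope sesquilinear_scope.

(** * Hermitian forms with one negative eigenvalue *)

Lemma char_poly_similar (R : comUnitRingType) n (P A : 'M[R]_n) :
  P \in unitmx -> char_poly (invmx P *m A *m P) = char_poly A.
Proof.
move=> uP; pose P' := map_mx (@polyC R) P.
have PP' : map_mx polyC (invmx P) *m P' = 1%:M.
  by rewrite -map_mxM mulVmx // map_mx1.
rewrite /char_poly -[RHS]mul1r -(det1 _ n) -PP' det_mulmx mulrAC -!det_mulmx.
congr (\det _); rewrite /char_poly_mx !map_mxM -/P' mulmxBr mulmxBl; congr (_ - _).
by rewrite scalar_mxC -mulmxA PP' mulmx1.
Qed.

Section HermitianForm.
Variables (C : numClosedFieldType) (n : nat) (A : 'M[C]_n).

Definition hform (x y : 'rV[C]_n) : C := (x *m A *m y^t*) 0 0.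

Lemma hformDl x x' y : hform (x + x') y = hform x y + hform x' y.
Proof. by rewrite /hform !mulmxDl mxE. Qed.

Lemma hformNl x y : hform (- x) y = - hform x y.
Proof. by rewrite /hform !mulNmx mxE. Qed.

Lemma hformZl a x y : hform (a *: x) y = a * hform x y.
Proof. by rewrite /hform -!scalemxAl mxE. Qed.

Lemma hform_delta i j : hform (delta_mx 0 i) (delta_mx 0 j) = A i j.
Proof.
by rewrite /hform trmx_delta map_delta_mx -rowE -colE !mxE.
Qed.

Hypothesis A_herm : A \is hermsymmx.

Let A_conj : A^t* = A.
Proof. by have /is_hermitianmxP := A_herm; rewrite expr0 scale1r => <-. Qed.

Lemma hformC x y : (hform x y)^* = hform y x.
Proof.
rewrite /hform; have -> : y *m A *m x^t* = (x *m A *m y^t*)^t*.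
  by rewrite !trmx_mul !map_mxM trmxCK A_conj mulmxA.
by rewrite [RHS]mxE [in RHS]mxE.
Qed.

Lemma hformDr x y y' : hform x (y + y') = hform x y + hform x y'.
Proof. by rewrite -hformC hformDl rmorphD /= !hformC. Qed.

Lemma hformNr x y : hform x (- y) = - hform x y.
Proof. by rewrite -hformC hformNl rmorphN /= !hformC. Qed.

Lemma hformZr a x y : hform x (a *: y) = a^* * hform x y.
Proof. by rewrite -hformC hformZl rmorphM /= !hformC. Qed.

Definition hformE := (hformDl, hformDr, hformNl, hformNr, hformZl, hformZr).

Lemma eigenvalues_spectral_diag (s : seq C) :
    char_poly A = \prod_(z <- s) ('X - z%:P) ->
  perm_eq s [seq spectral_diag A 0 i | i : 'I_n].
Proof.
move=> sE; apply: prod_XsubC_eq; rewrite -sE.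
have /hermitian_normalmx /orthomx_spectralP {1}-> := A_herm.
rewrite char_poly_similar ?spectral_unit // char_poly_trig ?diag_mx_is_trig //.
rewrite big_image /=; apply: eq_bigr => i _.
by rewrite mxE eqxx mulr1n.
Qed.

(** In the spectral basis the form is a weighted sum of squared norms. *)
Lemma hform_spectral x (x' := x *m (spectralmx A)^t*) :
  hform x x = \sum_i spectral_diag A 0 i * `|x' 0 i| ^+ 2.
Proof.
have /hermitian_normalmx /orthomx_spectralP AE := A_herm.
rewrite /hform [X in _ *m X *m _]AE invmx_unitary ?spectral_unitarymx //.
rewrite !mulmxA -/x' -mulmxA.
have -> : spectralmx A *m x^t* = x'^t* by rewrite trmx_mul map_mxM trmxCK.
rewrite mxE; apply: eq_bigr => i _.
rewrite mul_mx_diag [X in X * _]mxE [X in _ * X]mxE [x'^T _ _]mxE normCK; ring.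
Qed.

Hypothesis one_neg : count (fun i => spectral_diag A 0 i < 0) (enum 'I_n) = 1%N.

(** The linear form [l] is the coordinate along the unique negative
    eigenvector. *)
Lemma hform_ge0_hyperplane :
  exists l : 'cV[C]_n, forall x, x *m l = 0 -> 0 <= hform x x.
Proof.
have : has (fun i => spectral_diag A 0 i < 0) (enum 'I_n).
  by rewrite has_count one_neg.
case/hasP => i0 _ di0; exists (col i0 ((spectralmx A)^t*)) => x.
rewrite colE mulmxA -colE => /matrixP /(_ 0 0); rewrite mxE [RHS]mxE => x0.
rewrite hform_spectral; apply: sumr_ge0 => i _.
have [->|i_i0] := eqVneq i i0; first by rewrite x0 normr0 expr0n mulr0.
rewrite mulr_ge0 ?exprn_ge0 ?normr_ge0 //.
have := hermitian_spectral_diag_real A_herm => /mxOverP /(_ 0 i).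
rewrite realE => /orP[//|]; rewrite le_eqVlt => /predU1P[-> //|di].
suff : (1 < 1)%N by [].
rewrite -[X in (_ < X)%N]one_neg -size_filter; set s := filter _ _.
have /card_uniqP <- : uniq s by rewrite filter_uniq ?enum_uniq.
apply/card_gt1P; exists i, i0.
by split; rewrite // mem_filter mem_enum ?di ?di0.
Qed.

(** Otherwise [n0] and [y] would span a plane on which the form is negative
    definite, and a plane always meets the hyperplane of
    [hform_ge0_hyperplane]. *)
Lemma hform_orth_neg_ge0 n0 y :
  hform n0 n0 < 0 -> hform y n0 = 0 -> 0 <= hform y y.
Proof.
have [l l_ge0] := hform_ge0_hyperplane; move=> n0_neg y_n0.
have n0_y : hform n0 y = 0 by rewrite -hformC y_n0 conjC0.
pose a := (y *m l) 0 0; pose b := (n0 *m l) 0 0.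
have b_neq0 : b != 0.
  apply/negP => /eqP b0; have : 0 <= hform n0 n0.
    by apply: l_ge0; apply/matrixP => i j; rewrite !ord1 -/b b0 mxE.
  by rewrite lt_geF.
(* This combination is in the hyperplane, and is nonzero since [b != 0]. *)
have : 0 <= hform (b *: y - a *: n0) (b *: y - a *: n0).
  apply: l_ge0; rewrite mulmxBl -!scalemxAl.
  rewrite [y *m l]mx11_scalar [n0 *m l]mx11_scalar -/a -/b.
  by rewrite !scale_scalar_mx mulrC subrr.
rewrite !hformE y_n0 n0_y !(mulr0, oppr0, addr0, add0r, mulrN, opprK, mulrA).
rewrite -!normCK => ge0; rewrite -(@pmulr_rge0 _ (`|b| ^+ 2)) ?exprn_gt0 ?normr_gt0 //.
apply: le_trans ge0 _; rewrite gerDl; apply: mulr_ge0_le0; last exact: ltW.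
by rewrite exprn_ge0.
Qed.

(** On the orthogonal of [n0] the form is nonnegative, so Cauchy-Schwarz
    places an isotropic [y] in its radical; [y] is orthogonal to [n0] as well,
    which is a complement. *)
Lemma hform_orth_neg_eq0 n0 y :
  hform n0 n0 < 0 -> hform y n0 = 0 -> hform y y = 0 -> y *m A = 0.
Proof.
move=> n0_neg y_n0 y0.
suff y_perp z : hform y z = 0.
  apply/rowP => j; have := y_perp (delta_mx 0 j).
  rewrite /hform trmx_delta map_delta_mx -colE.
  by rewrite [col _ _ _ _]mxE => ->; rewrite mxE.
pose z' := z - (hform z n0 / hform n0 n0) *: n0.
have n0_y : hform n0 y = 0 by rewrite -hformC y_n0 conjC0.
have z'_n0 : hform z' n0 = 0.
  by rewrite /z' !hformE divfK ?subrr // lt_eqF.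
have yz' : hform y z' = hform y z.
  by rewrite /z' !hformE y_n0 mulr0 subr0.
rewrite -{}yz'; move: z' z'_n0 => {}z z_n0.
apply/eqP/negP => /negP b_neq0.
have q_ge0 : 0 <= hform z z by apply: hform_orth_neg_ge0 z_n0.
have N_gt0 : 0 < `|hform y z| ^+ 2 by rewrite exprn_gt0 ?normr_gt0.
(* If [hform y z != 0], a large multiple of [y] makes [z - _ *: y] negative:
   [r] is chosen to reach the value [- hform z z - 2]. *)
pose r := (hform z z + 1) / `|hform y z| ^+ 2.
have r_conj : r^* = r.
  by apply: CrealP; rewrite ger0_real // divr_ge0 ?ltW // ltr_wpDl.
pose x := z - (r * hform z y) *: y.
have : 0 <= hform x x.
  apply: (hform_orth_neg_ge0 n0_neg).
  by rewrite /x !hformE z_n0 y_n0 mulr0 subr0.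
have -> : hform x x = hform z z - 2 * (r * `|hform y z| ^+ 2).
  rewrite /x !hformE y0 rmorphM /= r_conj hformC normCK hformC; ring.
rewrite /r divfK ?gt_eqF // => le0.
have: hform z z <= - 2.
  rewrite -subr_ge0; move: le0; congr (0 <= _); ring.
move/(le_trans q_ge0); rewrite oppr_ge0 => /(lt_le_trans (ltr0Sn _ 1)).
by rewrite ltxx.
Qed.

End HermitianForm.

(** * Entries of the Hermitian adjacency matrix *)

Section Entries.
Variables (C : numClosedFieldType) (D : digraph).
Local Notation h := (@herm C D).
Local Notation arc := Defs.arc.

Variant herm_spec (u v : D) : C -> C -> bool -> bool -> Prop :=
  | HermNone : herm_spec u v 0 0 false false
  | HermDigon : herm_spec u v 1 1 true true
  | HermOut : herm_spec u v 'i (- 'i) true false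
  | HermIn : herm_spec u v (- 'i) 'i false true.

Lemma hermP u v : herm_spec u v (h u v) (h v u) (arc D u v) (arc D v u).
Proof. by rewrite /herm; case: (arc D u v); case: (arc D v u); constructor. Qed.

Lemma herm_values u v :
  [\/ h u v = 0 /\ h v u = 0, h u v = 1 /\ h v u = 1,
      h u v = 'i /\ h v u = - 'i | h u v = - 'i /\ h v u = 'i].
Proof.
by case: (hermP u v); [constructor 1 | constructor 2 | constructor 3 | constructor 4].
Qed.

Lemma conj_herm u v : (h u v)^* = h v u.
Proof.
by case: hermP; rewrite ?rmorphN /= ?conjCi ?opprK ?conjC0 ?conjC1.
Qed.

Lemma herm_diag u : h u u = 0.
Proof. by rewrite /herm arc_irr. Qed.

Lemma neq_N1_1 : (-1 == 1 :> C) = false.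
Proof. by rewrite eq_sym -subr_eq0 opprK (pnatr_eq0 C 2). Qed.

Lemma Ci_eq1 : ('i == 1 :> C) = false.
Proof.
apply/eqP => /(congr1 (fun x => x ^+ 2)) /eqP.
by rewrite sqrCi expr1n neq_N1_1.
Qed.

Lemma Ci_eqN1 : ('i == -1 :> C) = false.
Proof.
apply/eqP => /(congr1 (fun x => x ^+ 2)) /eqP.
by rewrite sqrCi sqrrN expr1n neq_N1_1.
Qed.

Lemma Ci_eqN : ('i == - 'i :> C) = false.
Proof.
by rewrite -subr_eq0 opprK -mulr2n -mulr_natl mulf_eq0 pnatr_eq0 (negPf (neq0Ci C)).
Qed.

Lemma herm_neqN1 u v : h u v <> -1.
Proof.
case: hermP => /eqP; rewrite ?[0 == _]eq_sym ?[1 == _]eq_sym ?oppr_eq0 ?oner_eq0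
  ?neq_N1_1 ?Ci_eqN1 //.
by rewrite eqr_opp Ci_eq1.
Qed.

(** Evaluates products and sums of the values [0], [1], [-1], ['i] and
    [- 'i]. *)
Definition gaussE :=
  (@mulr0 C, @mul0r C, @mulr1 C, @mul1r C, @add0r C, @addr0 C, @mulrN C, @mulNr C,
   @opprK C, mulCii C, @oppr0 C, @subrr C, @addNr C).

(** Excludes Gaussian integers such as [1 + 'i] as entries. *)
Lemma herm_sqr_norm2 u v : h u v * h v u <> 2.
Proof.
have n02 : 0 <> 2 :> C by move=> /eqP; rewrite eq_sym pnatr_eq0.
have n12 : 1 <> 2 :> C.
  by move=> /eqP; rewrite -subr_eq0 (_ : 1 - 2 = -1 :> C) ?oppr_eq0 ?oner_eq0 //; ring.
by case: hermP; rewrite ?gaussE.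
Qed.

End Entries.

(** * Recognizing a twin reduction *)

Section TwinReduction.
Variables (C : numClosedFieldType) (D : digraph).
Local Notation h := (@herm C D).
Local Notation arc := Defs.arc.

Lemma arc_herm (G : digraph) (u v : G) :
  arc G u v = (herm C u v == 1) || (herm C u v == 'i).
Proof.
case: (hermP C u v); rewrite ?eqxx ?orbT //.
  by rewrite [0 == 1]eq_sym oner_eq0 [0 == 'i]eq_sym (negPf (neq0Ci C)).
by rewrite eqr_oppLR Ci_eqN1 eq_sym Ci_eqN.
Qed.

Lemma isolated_herm u : reflect (forall x, h u x = 0) (isolated u).
Proof.
apply: (iffP forallP) => [u_iso x | u_iso x].
  by have := u_iso x; case: (hermP C u x).
have := u_iso x; case: (hermP C u x) => // /eqP; rewrite ?oppr_eq0.
- by rewrite oner_eq0.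
- by rewrite (negPf (neq0Ci C)).
- by rewrite (negPf (neq0Ci C)).
Qed.

Lemma twinsP u v : reflect (forall x, h u x = h v x) (twins C u v).
Proof. by apply: (iffP forallP) => uv x; [apply/eqP | rewrite uv]. Qed.

Lemma twins_equiv : {in [set: D] & &, equivalence_rel (@twins C D)}.
Proof.
move=> u v w _ _ _; split; first exact/twinsP.
move=> /twinsP uv; apply/twinsP/twinsP => uw x; first by rewrite -uv uw.
by rewrite uv uw.
Qed.

Local Notation P := (equivalence_partition (@twins C D) [set: D]).

Lemma twin_classes_transversal :
  is_transversal (twin_representatives C D) P [set: D].
Proof. exact: transversalP (equivalence_partitionP twins_equiv). Qed.

Lemma in_twin_class u v : (v \in pblock P u) = twins C u v.
Proof. by apply: (pblock_equivalence_partition twins_equiv); rewrite inE. Qed.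

Lemma twin_class_mem u : pblock P u \in P.
Proof.
rewrite pblock_mem //; have /and3P[/eqP -> _ _] := equivalence_partitionP twins_equiv.
by rewrite inE.
Qed.

Lemma ex_twin_representative u :
  exists2 r, r \in twin_representatives C D & twins C u r.
Proof.
have tr := twin_classes_transversal; have Pu := twin_class_mem u.
exists (transversal_repr u (twin_representatives C D) (pblock P u)).
  exact: (repr_mem_transversal tr).
by rewrite -in_twin_class; apply: (repr_mem_pblock tr).
Qed.

Lemma twin_representatives_inj :
  {in twin_representatives C D &, forall r r', twins C r r' -> r = r'}.
Proof.
move=> r r' rR r'R rr'; apply: (pblock_inj twin_classes_transversal) => //.
have /and3P[_ tI _] := equivalence_partitionP twins_equiv.
by apply/esym/(def_pblock tI (twin_class_mem r)); rewrite in_twin_class.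
Qed.

(** A copy [f] of a digraph [T] meets every class of twins of non-isolated
    vertices exactly once when [T] is itself reduced and the rows of [D] are
    those of the copy. The arcs between representatives are those of the copy
    because twins have equal rows and, by Hermitian symmetry, equal columns. *)
Lemma twin_reduction_isomorphic (T : digraph) (f : T -> D) :
    (forall a b, h (f a) (f b) = herm C a b) ->
    (forall a b : T, twins C a b -> a = b) ->
    (forall a : T, ~~ isolated a) ->
    (forall u, (forall x, h u x = 0) \/ exists a, forall x, h u x = h (f a) x) ->
  isomorphic (twin_reduction C D) T.
Proof.
move=> f_herm T_twin_free T_noniso cover.
pose S := [set u in twin_representatives C D | ~~ isolated u].
have S_ex (u : {x | x \in S}) : exists a, twins C (val u) (f a).
  case: u => u /=; rewrite inE => /andP[_ /negP u_niso].
  case: (cover u) => [/isolated_herm //|[a ua]]; exists a; exact/twinsP.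
have T_ex a : exists u : {x | x \in S}, twins C (val u) (f a).
  have [r rR /twinsP ar] := ex_twin_representative (f a).
  have rS : r \in S.
    rewrite inE rR; apply/negP => /isolated_herm r0.
    have /negP := T_noniso a; apply; apply/forallP => b.
    have : herm C a b = 0 by rewrite -f_herm ar.
    case: (hermP C a b) => // /eqP; rewrite ?oppr_eq0 ?oner_eq0 //.
      by rewrite (negPf (neq0Ci C)).
    by rewrite (negPf (neq0Ci C)).
  by exists (Sub r rS); apply/twinsP => x /=.
pose phi u := xchoose (S_ex u); pose g a := xchoose (T_ex a).
have phiP u : twins C (val u) (f (phi u)) by apply: xchooseP (S_ex u).
have gP a : twins C (val (g a)) (f a) by apply: xchooseP (T_ex a).
exists phi.
  exists g => [u | a].
    apply: val_inj; have := valP (g (phi u)); have := valP u; rewrite !inE.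
    move=> /andP[uR _] /andP[gR _]; apply: twin_representatives_inj => //.
    by apply/twinsP => x; rewrite (twinsP _ _ (gP _)) (twinsP _ _ (phiP u)).
  apply: T_twin_free; apply/forallP => b; apply/eqP.
  by rewrite -!f_herm -(twinsP _ _ (phiP _)) (twinsP _ _ (gP a)).
move=> u v; rewrite [RHS]/= !arc_herm.
suff -> : herm C (phi u) (phi v) = h (val u) (val v) by [].
rewrite -f_herm -(twinsP _ _ (phiP u)) -conj_herm -(twinsP _ _ (phiP v)).
exact: conj_herm.
Qed.

End TwinReduction.

Lemma twins_arc (C : numClosedFieldType) (T : digraph) (a b : T) :
  twins C a b ->
  forall c, Defs.arc T a c = Defs.arc T b c /\ Defs.arc T c a = Defs.arc T c b.
Proof.
move=> /forallP ab c; rewrite !(arc_herm C) -!(conj_herm C a) -!(conj_herm C b).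
by rewrite (eqP (ab c)).
Qed.

Section Concrete.
Variable C : numClosedFieldType.

(** Computable form of the absence of twins among the vertices [1, ..., n] of
    the relation [e]. *)
Definition twin_free_arcs n (e : rel nat) :=
  all (fun a => all (fun b => (a == b) ||
    has (fun c => (e a c != e b c) || (e c a != e c b)) (iota 1 n)) (iota 1 n)) (iota 1 n).

Lemma digraph_of_arcs_twin_free n s (s_irr : all (fun p => p.1 != p.2) s) :
  twin_free_arcs n (fun a b => (a, b) \in s) ->
  forall a b : @digraph_of_arcs n s s_irr, twins C a b -> a = b.
Proof.
move=> sep a b /twins_arc ab; apply/val_inj/eqP.
have in_iota (i : 'I_n) : i.+1 \in iota 1 n by rewrite mem_iota /= add1n ltnS ltn_ord.
have /orP[//|/hasP[c]] := allP (allP sep _ (in_iota a)) _ (in_iota b).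
rewrite mem_iota => /andP[c_gt0 c_le].
have c_lt : (c.-1 < n)%N by rewrite prednK.
have [/= + +] := ab (Ordinal c_lt).
by rewrite /= (prednK c_gt0) => -> ->; rewrite !eqxx.
Qed.

Lemma digraph_of_arcs_not_isolated n s (s_irr : all (fun p => p.1 != p.2) s) :
  all (fun a => has (fun c => ((a, c) \in s) || ((c, a) \in s)) (iota 1 n)) (iota 1 n) ->
  forall a : @digraph_of_arcs n s s_irr, ~~ isolated a.
Proof.
move=> conn a; apply/forallPn.
have in_iota (i : 'I_n) : i.+1 \in iota 1 n by rewrite mem_iota /= add1n ltnS ltn_ord.
have /hasP[c] := allP conn _ (in_iota a).
rewrite mem_iota => /andP[c_gt0 c_le] ac.
have c_lt : (c.-1 < n)%N by rewrite prednK.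
by exists (Ordinal c_lt); rewrite /= (prednK c_gt0) -negb_or negbK.
Qed.

End Concrete.

(** * Consequences of a single negative eigenvalue *)

Section OneNegative.
Variables (C : numClosedFieldType) (D : digraph).
Local Notation h := (@herm C D).
Local Notation H := (herm_mx C D).
Local Notation e u := (delta_mx 0 (enum_rank u) : 'rV[C]_#|D|).

Lemma herm_mx_hermitian : H \is hermsymmx.
Proof.
apply/is_hermitianmxP; rewrite expr0 scale1r; apply/matrixP => i j.
by rewrite !mxE conj_herm.
Qed.

Lemma hform_e u v : hform H (e u) (e v) = h u v.
Proof. by rewrite hform_delta mxE !enum_rankK. Qed.

Hypothesis one_neg : num_neg_eigenvalues C D = 1%N.

Lemma count_neg_spectral_diag :
  count (fun i => spectral_diag H 0 i < 0) (enum 'I_#|D|) = 1%N.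
Proof.
move: one_neg; rewrite /num_neg_eigenvalues /eigenvalues.
case: closed_field_poly_normal => s /= sE.
rewrite (monicP (char_poly_monic _)) scale1r in sE.
have /permP -> := eigenvalues_spectral_diag herm_mx_hermitian sE.
by rewrite count_map.
Qed.

(** The vector [e_u - h_uv e_v] is negative, with value [-2]. *)
Lemma hform_orth_edge u v y :
    h u v != 0 -> hform H y (e u) = 0 -> hform H y (e v) = 0 ->
  0 <= hform H y y /\
  (hform H y y = 0 -> forall z, hform H y (e z) = 0).
Proof.
move=> uv yu yv; have Hh := herm_mx_hermitian.
pose n0 := e u - h u v *: e v.
have n0_neg : hform H n0 n0 < 0.
  suff -> : hform H n0 n0 = - (2 * `|h u v| ^+ 2).
    by rewrite oppr_lt0 mulr_gt0 ?ltr0n // exprn_gt0 // normr_gt0.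
  rewrite /n0 !(hformE Hh) !hform_e !herm_diag normCK conj_herm; ring.
have y_n0 : hform H y n0 = 0.
  by rewrite /n0 !(hformE Hh) yu yv mulr0 subr0.
split=> [|y0 z]; first exact: hform_orth_neg_ge0 count_neg_spectral_diag _ _ n0_neg y_n0.
have yH := hform_orth_neg_eq0 Hh count_neg_spectral_diag n0_neg y_n0 y0.
by rewrite /hform yH mul0mx mxE.
Qed.

(** The number [t] is twice the real part of the weight of the triangle
    [w u v], and [- t] is the value of the form at the component [y] of [e_w]
    orthogonal to [e_u] and [e_v]. The conclusion on rows says that [y] is in
    the kernel. *)
Lemma triangle_weight u v w :
    h u v != 0 ->
  let t := h w u * h u v * h v w + h w v * h v u * h u w in
  t <= 0 /\
  (t = 0 -> forall x, h w x = h w u * h u v * h v x + h w v * h v u * h u x).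
Proof.
move=> uv t; have Hh := herm_mx_hermitian.
have uv1 : h u v * h v u = 1.
  by move: uv; case: hermP => [/eqP//|||] _;
    rewrite ?mulr1 ?mulrN ?mulNr ?mulCii ?opprK.
pose y := e w - (h w u * h u v) *: e v - (h w v * h v u) *: e u.
have yE x : hform H y (e x) =
    h w x - (h w u * h u v * h v x + h w v * h v u * h u x).
  by rewrite /y !(hformE Hh) !hform_e; ring.
have yu : hform H y (e u) = 0.
  by rewrite yE herm_diag -(mulrA (h w u)) uv1; ring.
have yv : hform H y (e v) = 0.
  by rewrite yE herm_diag -(mulrA (h w v)) (mulrC (h v u)) uv1; ring.
have yy : hform H y y = - t.
  rewrite {2}/y; do !rewrite ?(hformDr Hh) ?(hformNr Hh) ?(hformZr Hh).
  by rewrite yu yv yE herm_diag /t; ring.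
have [] := hform_orth_edge uv yu yv.
rewrite yy oppr_ge0 => -> y_ker; split=> // t0 x.
by apply/eqP; rewrite -subr_eq0 -yE y_ker // t0 oppr0.
Qed.

(** Here [e_w - s e_z] is orthogonal to the edge, and the form takes there the
    value [- s (h_wz + h_zw)]. *)
Lemma proportional_on_edge u v w z (s : C) :
    h u v != 0 -> s = 1 \/ s = -1 ->
    h w u = s * h z u -> h w v = s * h z v ->
  s * (h w z + h z w) <= 0 /\
  (h w z + h z w = 0 -> forall x, h w x = s * h z x).
Proof.
move=> uv s_sign wu wv; have Hh := herm_mx_hermitian.
pose y := e w - s *: e z.
have yE x : hform H y (e x) = h w x - s * h z x.
  by rewrite /y !(hformE Hh) !hform_e.
have yy : hform H y y = - (s * (h w z + h z w)).
  rewrite {2}/y !(hformDr Hh) !(hformNr Hh) !(hformZr Hh) !yE !herm_diag.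
  have -> : s^* = s by case: s_sign => ->; rewrite ?rmorphN /= conjC1.
  ring.
have [||ge0 y_ker] := hform_orth_edge (y := y) uv.
- by rewrite yE wu subrr.
- by rewrite yE wv subrr.
rewrite -oppr_ge0 -yy; split=> // wz x.
by apply/eqP; rewrite -subr_eq0 -yE y_ker // yy wz mulr0 oppr0.
Qed.

End OneNegative.

Section Rank.
Variables (C : numClosedFieldType) (D : digraph).
Local Notation h := (@herm C D).
Local Notation H := (herm_mx C D).

Lemma rank_le_span k (g : 'I_k -> D) :
    (forall w, exists c : 'I_k -> C, forall x, h w x = \sum_j c j * h (g j) x) ->
  (rank C D <= k)%N.
Proof.
move=> spanned; pose N := \matrix_(j < k) row (enum_rank (g j)) H.
suff HN : (H <= N)%MS by apply: leq_trans (mxrankS HN) (rank_leq_row N).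
apply/row_subP => i; have [c cE] := spanned (enum_val i).
suff -> : row i H = (\row_j c j) *m N by apply: submxMl.
apply/rowP => x; rewrite !mxE cE; apply: eq_bigr => j _.
by rewrite !mxE enum_rankK.
Qed.

Lemma rank_ge_free k (g : 'I_k -> D) :
    (forall c : 'I_k -> C, (forall x, \sum_j c j * h (g j) x = 0) -> forall j, c j = 0) ->
  (k <= rank C D)%N.
Proof.
move=> free; pose N := \matrix_(j < k) row (enum_rank (g j)) H.
have NH : (N <= H)%MS by apply/row_subP => i; rewrite rowK row_sub.
suff /eqP <- : row_free N by apply: mxrankS.
apply: inj_row_free => v vN; apply/rowP => j; rewrite [RHS]mxE.
apply: (free (fun j => v 0 j)) => x.
have /rowP /(_ (enum_rank x)) := vN; rewrite !mxE => vx; rewrite -[RHS]vx.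
by apply: eq_bigr => i _; rewrite !mxE !enum_rankK.
Qed.

Hypothesis one_neg : num_neg_eigenvalues C D = 1%N.

(** For a fixed edge, triangles whose weights all have a zero real part make
    every row a combination of the two rows of the edge. A triangle of weight
    [-1] has exactly one digon and two arcs contributing equally, and its
    vertices can be named so that the digon is [u1 u2]. *)
Lemma ex_negative_triangle :
  (2 < rank C D)%N ->
  exists u1 u2 u3 : D, [/\ h u1 u2 = 1, h u1 u3 = 'i & h u2 u3 = - 'i].
Proof.
move=> rank_gt2.
have [u [v uv]] : exists u v : D, h u v != 0.
  have [/existsP[u /existsP[v uv]]|no_edge] := boolP [exists u, exists v, h u v != 0].
    by exists u, v.
  suff: (rank C D <= 0)%N by rewrite leqn0 => /eqP r0; rewrite r0 in rank_gt2.
  apply: (@rank_le_span 0 (fun j => match notF (valP j) with end)) => w.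
  exists (fun=> 0) => x; rewrite big_ord0; apply/eqP/negPn/negP => wx.
  by move/existsPn: no_edge => /(_ w) /existsPn /(_ x); rewrite wx.
pose t w := h w u * h u v * h v w + h w v * h v u * h u w.
have [/existsP[w tw_neq0]|no_triangle] := boolP [exists w, t w != 0]; last first.
  suff: (rank C D <= 2)%N by rewrite leqNgt rank_gt2.
  pose g (j : 'I_2) := nth u [:: u; v] j; apply: (@rank_le_span 2 g) => w.
  exists (fun j => nth 0 [:: h w v * h v u; h w u * h u v] j) => x.
  have [_ ->] := triangle_weight one_neg w uv.
    by rewrite !big_ord_recl big_ord0 addr0 addrC.
  by apply/eqP/negPn; have /existsPn := no_triangle; apply.
have [] := triangle_weight one_neg w uv; rewrite -/(t w) => t_le _.
move: tw_neq0 t_le; rewrite /t.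
case: (herm_values C w u) => [[-> ->]|[a a']|[a a']|[a a']];
  rewrite ?gaussE ?eqxx //;
  case: (herm_values C u v) => [[b b']|[b b']|[b b']|[b b']];
  rewrite ?b ?b' ?gaussE ?eqxx //;
  case: (herm_values C v w) => [[c c']|[c c']|[c c']|[c c']];
  rewrite ?a ?a' ?c ?c' ?gaussE ?eqxx // => _; rewrite -?[1 + 1]/(2%:R) ?lern0 // => _.
all: first [ by exists w, u, v | by exists u, v, w | by exists v, w, u
  | by exists u, w, v | by exists v, u, w | by exists w, v, u].
Qed.

End Rank.

(** * Digraphs containing a negative triangle *)

Section NegativeTriangle.
Variables (C : numClosedFieldType) (D : digraph).
Local Notation h := (@herm C D).
Hypothesis one_neg : num_neg_eigenvalues C D = 1%N.
Variables u1 u2 u3 : D.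
Hypotheses (h12 : h u1 u2 = 1) (h13 : h u1 u3 = 'i) (h23 : h u2 u3 = - 'i).

Let h21 : h u2 u1 = 1. Proof. by rewrite -conj_herm h12 conjC1. Qed.
Let h31 : h u3 u1 = - 'i. Proof. by rewrite -conj_herm h13 conjCi. Qed.
Let h32 : h u3 u2 = 'i. Proof. by rewrite -conj_herm h23 rmorphN /= conjCi opprK. Qed.
Let edge12 : h u1 u2 != 0. Proof. by rewrite h12 oner_neq0. Qed.

(** Besides isolated vertices and twins of the triangle, [RowOpp3] is the fourth
    vertex of [T_neg_a], [RowMul2] and [RowMul1] are two positions of the fourth
    vertex of [T_neg_b], and [RowApex] is the fourth vertex of [K_neg]. Only the
    last one is not a combination of the rows of the triangle. *)
Variant row_spec (w : D) : Prop :=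
  | RowZero of forall x, h w x = 0
  | Row1 of forall x, h w x = h u1 x
  | Row2 of forall x, h w x = h u2 x
  | Row3 of forall x, h w x = h u3 x
  | RowOpp3 of forall x, h w x = - h u3 x
  | RowMul2 of forall x, h w x = 'i * h u2 x
  | RowMul1 of forall x, h w x = - 'i * h u1 x
  | RowApex of h w u1 = 'i & h w u2 = - 'i & h w u3 = 1.

(** The values [(h_wu1, h_wu2)] are enumerated. If the triangle [w u1 u2] has
    weight of real part 0, the row of [w] is known and its entry at [u3] must be
    admissible. A positive weight is impossible. Weight [-1] leaves
    [('i, - 'i)] and [(- 'i, 'i)], the opposite and the same values as [u3]. *)
Lemma row_classification w : row_spec w.
Proof.
have c1 := @herm_neqN1 C D w u3; have c2 := @herm_sqr_norm2 C D w u3.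
have [] := triangle_weight one_neg w edge12.
rewrite h12 h21 !mulr1.
case: (herm_values C w u1) => [[a a']|[a a']|[a a']|[a a']];
  case: (herm_values C w u2) => [[b b']|[b b']|[b b']|[b b']];
  rewrite a a' b b' ?gaussE => t_le t_eq; try move/(_ erefl): t_eq => t_eq;
  try (have := t_eq u3; rewrite h13 h23 ?gaussE => c); try by case: c1.
all: try by case: c2; rewrite -(conj_herm C w) c !(rmorphD, rmorphN) /= conjCi conjC1;
  ring: (sqrCi C).
all: try by move: t_le; rewrite -[1 + 1]/(2%:R) lern0.
- by apply: RowZero => x; rewrite t_eq ?gaussE.
- by apply: Row1 => x; rewrite t_eq ?gaussE.
- by apply: RowMul1 => x; rewrite t_eq ?gaussE.
- by apply: Row2 => x; rewrite t_eq ?gaussE.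
- by apply: RowMul2 => x; rewrite t_eq ?gaussE.
- have [|||_ eq_row] := @proportional_on_edge C D one_neg u1 u2 w u3 (-1) edge12; first by right.
  + by rewrite a h31 ?gaussE.
  + by rewrite b h32 ?gaussE.
  case: (herm_values C w u3) => [[c c']|[c c']|[c c']|[c c']]; last first.
  + by apply: RowOpp3 => x; rewrite eq_row ?mulN1r // c c' addNr.
  + by apply: RowOpp3 => x; rewrite eq_row ?mulN1r // c c' subrr.
  + exact: RowApex.
  + by apply: RowOpp3 => x; rewrite eq_row ?mulN1r // c c' addr0.
have [|||s_le eq_row] := @proportional_on_edge C D one_neg u1 u2 w u3 1 edge12; first by left.
- by rewrite a h31 ?gaussE.
- by rewrite b h32 ?gaussE.
case: (herm_values C w u3) => [[c c']|[c c']|[c c']|[c c']]; last first.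
- by apply: Row3 => x; rewrite eq_row ?mul1r // c c' addNr.
- by apply: Row3 => x; rewrite eq_row ?mul1r // c c' subrr.
- by move: s_le; rewrite c c' mul1r -[1 + 1]/(2%:R) lern0.
- by apply: Row3 => x; rewrite eq_row ?mul1r // c c' addr0.
Qed.

Local Notation vertices w := (fun j : 'I_4 => nth u1 [:: u1; u2; u3; w] j).

(** A vertex of another further type would have an entry [-1] with [w]. *)
Lemma reduction_T_neg_a w :
  (forall x, h w x = - h u3 x) -> isomorphic (twin_reduction C D) T_neg_a.
Proof.
move=> w_row.
have w1 : h w u1 = 'i by rewrite w_row h31 opprK.
have w2 : h w u2 = - 'i by rewrite w_row h32.
have w3 : h w u3 = 0 by rewrite w_row herm_diag oppr0.
have o1 : h u1 w = - 'i by rewrite -conj_herm w1 conjCi.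
have o2 : h u2 w = 'i by rewrite -conj_herm w2 rmorphN /= conjCi opprK.
have o3 : h u3 w = 0 by rewrite -conj_herm w3 conjC0.
apply: (@twin_reduction_isomorphic C D T_neg_a (vertices w)).
- by move=> [[|[|[|[|a]]]] ia] // [[|[|[|[|b]]]] ib] //; rewrite [LHS]/=
    ?herm_diag ?h12 ?h13 ?h23 ?h21 ?h31 ?h32 ?w1 ?w2 ?w3 ?o1 ?o2 ?o3.
- exact: digraph_of_arcs_twin_free.
- exact: digraph_of_arcs_not_isolated.
move=> z; case: (row_classification z) => zE; first by left.
1-3: right.
- by exists (inord 0) => x; rewrite /= inordK //= zE.
- by exists (inord 1) => x; rewrite /= inordK //= zE.
- by exists (inord 2) => x; rewrite /= inordK //= zE.
- by right; exists (inord 3) => x; rewrite /= inordK //= zE w_row.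
- by case: (@herm_neqN1 C D z w); rewrite zE o2 mulCii.
- by case: (@herm_neqN1 C D z w); rewrite zE o1 mulNr mulrN opprK mulCii.
move=> z2 z3; case: (@herm_neqN1 C D w z).
by rewrite w_row -conj_herm z3 conjC1.
Qed.

Lemma reduction_T_neg_b w :
  (forall x, h w x = 'i * h u2 x) -> isomorphic (twin_reduction C D) T_neg_b.
Proof.
move=> w_row.
have w1 : h w u1 = 'i by rewrite w_row h21 mulr1.
have w2 : h w u2 = 0 by rewrite w_row herm_diag mulr0.
have w3 : h w u3 = 1 by rewrite w_row h23 mulrN mulCii opprK.
have o1 : h u1 w = - 'i by rewrite -conj_herm w1 conjCi.
have o2 : h u2 w = 0 by rewrite -conj_herm w2 conjC0.
have o3 : h u3 w = 1 by rewrite -conj_herm w3 conjC1.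
apply: (@twin_reduction_isomorphic C D T_neg_b (vertices w)).
- by move=> [[|[|[|[|a]]]] ia] // [[|[|[|[|b]]]] ib] //; rewrite [LHS]/=
    ?herm_diag ?h12 ?h13 ?h23 ?h21 ?h31 ?h32 ?w1 ?w2 ?w3 ?o1 ?o2 ?o3.
- exact: digraph_of_arcs_twin_free.
- exact: digraph_of_arcs_not_isolated.
move=> z; case: (row_classification z) => zE; first by left.
- by right; exists (inord 0) => x; rewrite /= inordK //= zE.
- by right; exists (inord 1) => x; rewrite /= inordK //= zE.
- by right; exists (inord 2) => x; rewrite /= inordK //= zE.
- by case: (@herm_neqN1 C D z w); rewrite zE o3.
- by right; exists (inord 3) => x; rewrite /= inordK //= zE w_row.
- by case: (@herm_neqN1 C D z w); rewrite zE o1 mulNr mulrN opprK mulCii.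
move=> z2 z3; case: (@herm_neqN1 C D w z).
by rewrite w_row -conj_herm z2 rmorphN /= conjCi opprK mulCii.
Qed.

(** Two apexes agree with each other on [u1 u2], so they are twins by
    [proportional_on_edge]; an apex and a vertex of another further type would
    have an entry [-1]. *)
Lemma reduction_K_neg w :
    h w u1 = 'i -> h w u2 = - 'i -> h w u3 = 1 ->
  rank C D = 4%N /\ isomorphic (twin_reduction C D) K_neg.
Proof.
move=> w1 w2 w3.
have o1 : h u1 w = - 'i by rewrite -conj_herm w1 conjCi.
have o2 : h u2 w = 'i by rewrite -conj_herm w2 rmorphN /= conjCi opprK.
have o3 : h u3 w = 1 by rewrite -conj_herm w3 conjC1.
pose g (j : 'I_4) := nth u1 [:: u1; u2; u3; w] j.
have cover z : (forall x, h z x = 0) \/ exists j, forall x, h z x = h (g j) x.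
  case: (row_classification z) => zE; first by left.
  - by right; exists (inord 0) => x; rewrite /g inordK //= zE.
  - by right; exists (inord 1) => x; rewrite /g inordK //= zE.
  - by right; exists (inord 2) => x; rewrite /g inordK //= zE.
  - by case: (@herm_neqN1 C D z w); rewrite zE o3.
  - by case: (@herm_neqN1 C D z w); rewrite zE o2 mulCii.
  - by case: (@herm_neqN1 C D z w); rewrite zE o1 mulNr mulrN opprK mulCii.
  move=> z2 z3; right; exists (inord 3) => x; rewrite /g inordK //=.
  have [||||s_le eq_row] := @proportional_on_edge C D one_neg u1 u2 z w 1.
  - by rewrite h12 oner_neq0.
  - by left.
  - by rewrite zE w1 mul1r.
  - by rewrite z2 w2 mul1r.
  rewrite eq_row ?mul1r //; move: s_le.
  case: (herm_values C z w) => [[-> ->]|[-> ->]|[-> ->]|[-> ->]];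
    rewrite ?addr0 ?subrr ?addNr // mul1r.
  by rewrite -[1 + 1]/(2%:R) lern0.
split; last first.
  apply: (@twin_reduction_isomorphic C D K_neg g) cover.
  - by move=> [[|[|[|[|a]]]] ia] // [[|[|[|[|b]]]] ib] //; rewrite [LHS]/=
      ?herm_diag ?h12 ?h13 ?h23 ?h21 ?h31 ?h32 ?w1 ?w2 ?w3 ?o1 ?o2 ?o3.
  - exact: digraph_of_arcs_twin_free.
  - exact: digraph_of_arcs_not_isolated.
apply/eqP; rewrite eqn_leq; apply/andP; split.
  apply: (@rank_le_span C D 4 g) => z.
  have [z0|[j zj]] := cover z.
    by exists (fun=> 0) => x; rewrite z0 big1 // => j _; rewrite mul0r.
  exists (fun i => (i == j)%:R) => x; rewrite (bigD1 j) //= eqxx mul1r.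
  by rewrite big1 ?addr0 // => i /negPf ->; rewrite mul0r.
apply: (@rank_ge_free C D 4 g) => c c_dep.
have := (c_dep u1, c_dep u2, c_dep u3, c_dep w).
rewrite !big_ord_recl !big_ord0 /g /= !herm_diag h12 h13 h23 h21 h31 h32 w1 w2 w3.
rewrite o1 o2 o3 ?gaussE.
set c0 := c ord0; set c1 := c (lift ord0 ord0).
set c2 := c (lift ord0 (lift ord0 ord0)).
set c3 := c (lift ord0 (lift ord0 (lift ord0 ord0))) => -[[[e1 e2] e3] e4].
(* The first two equations give [c0] and [c1] as multiples of [c2 - c3];
   substituting in the difference of the last two leaves [- 3 (c2 - c3) = 0]. *)
have /eqP : 3 * (c2 - c3) = 0.
  rewrite -[RHS](_ : c0 * 'i + (- (c1 * 'i) + c3) - (- (c0 * 'i) + (c1 * 'i + c2))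
    - 2 * 'i * (c0 + (c2 * 'i - c3 * 'i)) + 2 * 'i * (c1 + (- (c2 * 'i) + c3 * 'i)) = 0).
    by ring: (sqrCi C).
  by rewrite e1 e2 e3 e4 ?gaussE.
rewrite mulf_eq0 pnatr_eq0 subr_eq0 => /eqP c23.
have c1_0 : c1 = 0 by rewrite -e1 c23 addNr addr0.
have c0_0 : c0 = 0 by rewrite -e2 c23 subrr addr0.
have c3_0 : c3 = 0 by rewrite -e3 c0_0 c1_0 ?gaussE.
move=> [[|[|[|[|j]]]] ij] //; [rewrite -[RHS]c0_0 | rewrite -[RHS]c1_0
  | rewrite -[RHS]c3_0 -c23 | rewrite -[RHS]c3_0]; congr (c _); exact: val_inj.
Qed.

Lemma rank_le3 :
    (forall w, ~ [/\ h w u1 = 'i, h w u2 = - 'i & h w u3 = 1]) ->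
  (rank C D <= 3)%N.
Proof.
move=> no_apex; apply: (@rank_le_span C D 3 (fun j => nth u1 [:: u1; u2; u3] j)) => w.
suff [[[a b] c] wE] : exists c : C * C * C, forall x,
    h w x = c.1.1 * h u1 x + (c.1.2 * h u2 x + c.2 * h u3 x).
  exists (fun j => nth 0 [:: a; b; c] j) => x.
  by rewrite wE !big_ord_recl big_ord0 /= addr0.
case: (row_classification w) => wE.
- by exists (0, 0, 0) => x; rewrite wE ?gaussE.
- by exists (1, 0, 0) => x; rewrite wE ?gaussE.
- by exists (0, 1, 0) => x; rewrite wE ?gaussE.
- by exists (0, 0, 1) => x; rewrite wE ?gaussE.
- by exists (0, 0, -1) => x; rewrite wE ?gaussE.
- by exists (0, 'i, 0) => x; rewrite wE ?gaussE.
- by exists (- 'i, 0, 0) => x; rewrite wE ?gaussE.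
by move=> w2 w3; case: (no_apex w).
Qed.

Lemma reduction_T_neg :
    (forall w, ~ forall x, h w x = - h u3 x) ->
    (forall w, ~ forall x, h w x = 'i * h u2 x) ->
    (forall w, ~ forall x, h w x = - 'i * h u1 x) ->
    (forall w, ~ [/\ h w u1 = 'i, h w u2 = - 'i & h w u3 = 1]) ->
  isomorphic (twin_reduction C D) T_neg.
Proof.
move=> no_opp3 no_mul2 no_mul1 no_apex.
apply: (@twin_reduction_isomorphic C D T_neg (fun j : 'I_3 => nth u1 [:: u1; u2; u3] j)).
- by move=> [[|[|[|a]]] ia] // [[|[|[|b]]] ib] //; rewrite [LHS]/=
    ?herm_diag ?h12 ?h13 ?h23 ?h21 ?h31 ?h32.
- exact: digraph_of_arcs_twin_free.
- exact: digraph_of_arcs_not_isolated.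
move=> z; case: (row_classification z) => zE; first by left.
- by right; exists (inord 0) => x; rewrite /= inordK //= zE.
- by right; exists (inord 1) => x; rewrite /= inordK //= zE.
- by right; exists (inord 2) => x; rewrite /= inordK //= zE.
- by case: (no_opp3 z).
- by case: (no_mul2 z).
- by case: (no_mul1 z).
by move=> z2 z3; case: (no_apex z).
Qed.
End NegativeTriangle.

Theorem theorem4p8 (C : numClosedFieldType) (D : digraph)
    (order_ge5 : (5 <= #|D|)%N)
    (rank_gt2 : (2 < rank C D)%N)
    (one_neg_eigenvalue : num_neg_eigenvalues C D = 1%N) :
  (rank C D = 3%N /\
    (isomorphic (twin_reduction C D) T_neg \/
     isomorphic (twin_reduction C D) T_neg_a \/
     isomorphic (twin_reduction C D) T_neg_b))
  \/
  (rank C D = 4%N /\ isomorphic (twin_reduction C D) K_neg).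
Proof.
have [u1 [u2 [u3 [h12 h13 h23]]]] := ex_negative_triangle one_neg_eigenvalue rank_gt2.
have [/existsP[w /and3P[/eqP w1 /eqP w2 /eqP w3]]|no_apex] :=
  boolP [exists w, [&& herm C w u1 == 'i, herm C w u2 == - 'i & herm C w u3 == 1]].
  by right; apply: (reduction_K_neg one_neg_eigenvalue h12 h13 h23 w1 w2 w3).
left; have {}no_apex w : ~ [/\ herm C w u1 = 'i, herm C w u2 = - 'i & herm C w u3 = 1].
  by case=> w1 w2 w3; case/existsP: no_apex; exists w; rewrite w1 w2 w3 !eqxx.
split.
  apply/eqP; rewrite eqn_leq rank_gt2 andbT.
  exact: (rank_le3 one_neg_eigenvalue h12 h13 h23).
have [/existsP[w /forallP w_row]|no_opp3] :=
  boolP [exists w, forall x, herm C w x == - herm C u3 x].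
  right; left; apply: (reduction_T_neg_a one_neg_eigenvalue h12 h13 h23 (w := w)).
  by move=> x; apply/eqP.
have [/existsP[w /forallP w_row]|no_mul2] :=
  boolP [exists w, forall x, herm C w x == 'i * herm C u2 x].
  right; right; apply: (reduction_T_neg_b one_neg_eigenvalue h12 h13 h23 (w := w)).
  by move=> x; apply/eqP.
(* The digraph [T_neg_b] contains a second negative triangle, here [u3 w u2].
   With respect to it the fourth vertex is [u1] and has the type [RowMul2]. *)
have [/existsP[w /forallP w_row]|no_mul1] :=
  boolP [exists w, forall x, herm C w x == - 'i * herm C u1 x].
  have {}w_row x : herm C w x = - 'i * herm C u1 x by apply/eqP.
  have h3w : herm C u3 w = 1.
    by rewrite -conj_herm w_row h13 mulNr mulCii opprK conjC1.
  have h32 : herm C u3 u2 = 'i by rewrite -conj_herm h23 rmorphN /= conjCi opprK.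
  have hw2 : herm C w u2 = - 'i by rewrite w_row h12 mulr1.
  right; right; apply: (reduction_T_neg_b one_neg_eigenvalue h3w h32 hw2 (w := u1)).
  by move=> x; rewrite w_row mulNr mulrN mulrA mulCii mulN1r opprK.
left; apply: (reduction_T_neg one_neg_eigenvalue h12 h13 h23) => w.
- by move=> w_row; case/existsP: no_opp3; exists w; apply/forallP => x; apply/eqP.
- by move=> w_row; case/existsP: no_mul2; exists w; apply/forallP => x; apply/eqP.
- by move=> w_row; case/existsP: no_mul1; exists w; apply/forallP => x; apply/eqP.
exact: no_apex.
Qed.
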